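(* Let $F:\mathbb{R}^p\to\mathbb{R}^p$ be single-valued and $L$-Lipschitz continuous ($L>0$), let $T:\mathbb{R}^p\rightrightarrows 2^{\mathbb{R}^p}$ be possibly multivalued, and assume that $F+T$ is $\rho$-co-hypomonotone with $\rho\ge 0$ and $2L\rho<1$. Assume $\mathrm{zer}(F+T)\neq\emptyset$ and let $x^\star\in\mathrm{zer}(F+T)$ be an arbitrary solution. Let $\gamma>0$ be such that $L(2\rho+\gamma)\le 1$ (e.g., $\gamma:=\frac1L-2\rho>0$). Let $\{(x^k,y^k,z^k)\}$ (together with $w^k$, $\xi^k$) be generated by the scheme (AEG) described in the context, with the parameters $$t_k:=k+2,\quad \eta:=\gamma+2\rho,\quad \hat\eta_k:=\frac{(t_k-1)\eta}{t_k},\quad \theta_k:=\frac{t_k-1}{t_{k+1}},\quad \nu_k:=\frac{t_k}{t_{k+1}}.$$ Then, for all $k\ge 0$, $$\|Fx^k+\xi^k\|^2\le \frac{4\|x^0-x^\star\|^2+8\gamma(3\gamma+2\rho)\|Fx^0+\xi^0\|^2}{\gamma^2(k+2)^2},\qquad\text{where } \xi^k\in Tx^k.$$ If, in addition, $J_{\eta T}$ is nonexpansive, then for all $k\ge0$, $$\|\mathcal{G}_\eta x^k\|^2\le \frac{4\|x^0-x^\star\|^2+8\gamma(3\gamma+2\rho)\|Fx^0+\xi^0\|^2}{\gamma^2(k+2)^2}.$$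
   Context: $\mathbb{R}^p$ carries the standard inner product $\langle\cdot,\cdot\rangle$ and Euclidean norm $\|\cdot\|$. A (possibly multivalued) operator $G$ on $\mathbb{R}^p$ is $\rho$-co-hypomonotone if $\langle u-v,x-y\rangle\ge-\rho\|u-v\|^2$ for all $x,y$ and all $u\in Gx$, $v\in Gy$ (for $\rho=0$ this is monotonicity). $\mathrm{zer}(F+T):=\{x: 0\in Fx+Tx\}$. The resolvent is $J_{\eta T}u:=\{x\in\mathbb{R}^p: u\in x+\eta Tx\}$. ''$J_{\eta T}$ is nonexpansive'' means that $J_{\eta T}$ is a single-valued map $\mathbb{R}^p\to\mathbb{R}^p$ that is $1$-Lipschitz. In that case the residual operator is $\mathcal{G}_\eta x:=\frac1\eta\big(x-J_{\eta T}(x-\eta Fx)\big)$. Scheme (AEG): given $x^0\in\mathbb{R}^p$ with some $\xi^0\in Tx^0$, set $z^0=y^0:=x^0$, $w^0:=Fx^0+\xi^0$ and $w^{-1}:=\frac{\eta}{\hat\eta_0}w^0$. For $k\ge 0$, $$\begin{aligned} x^k&:=J_{\eta T}\big(y^k-\eta Fy^k+\hat\eta_k w^{k-1}\big),\\ w^k&:=\tfrac1\eta\big(y^k-x^k+\hat\eta_k w^{k-1}\big)+Fx^k-Fy^k,\\ z^{k+1}&:=x^k-\gamma w^k,\\ y^{k+1}&:=z^{k+1}+\theta_k(z^{k+1}-z^k)+\nu_k(y^k-z^{k+1}). \end{aligned}$$ For $k=0$ the first two lines are satisfied by the given $x^0$ and $w^0$. The iterates are assumed to exist; if $J_{\eta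 T}$ is multivalued, the first line means that $x^k$ is an element of the right-hand side (for $k=0$, the given $x^0$). The element $\xi^k$ is $\xi^k:=w^k-Fx^k=\frac1\eta(y^k-x^k+\hat\eta_kw^{k-1})-Fy^k\in Tx^k$, so that $w^k=Fx^k+\xi^k$. *)

(* Defs.v *)
From mathcomp Require Import all_boot all_order all_algebra.
From mathcomp Require Import boolp classical_sets reals.

Set Implicit Arguments.
Unset Strict Implicit.
Unset Printing Implicit Defensive.

Import Order.TTheory GRing.Theory Num.Theory.

Local Open Scope classical_set_scope.
Local Open Scope ring_scope.

Definition dotp (R : realType) (p : nat) (u v : 'rV[R]_p) : R :=
  \sum_i u 0 i * v 0 i.

(* The Euclidean norm; the norm that MathComp-Analysis puts on 'rV[R]_p is the
   sup norm. *)
Definition enorm (R : realType) (p : nat) (u : 'rV[R]_p) : R :=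
  Num.sqrt (dotp u u).

(* Lipschitz continuity with respect to the Euclidean norm. *)
Definition elipschitz (R : realType) (p : nat) (L : R)
    (f : 'rV[R]_p -> 'rV[R]_p) : Prop :=
  forall x y, enorm (f x - f y) <= L * enorm (x - y).

Definition cohypomonotone (R : realType) (p : nat) (rho : R)
    (G : 'rV[R]_p -> set 'rV[R]_p) : Prop :=
  forall x y u v, G x u -> G y v ->
    dotp (u - v) (x - y) >= - rho * enorm (u - v) ^+ 2.

(* The operator F + T, with F single-valued. *)
Definition opsum (R : realType) (p : nat) (F : 'rV[R]_p -> 'rV[R]_p)
    (T : 'rV[R]_p -> set 'rV[R]_p) : 'rV[R]_p -> set 'rV[R]_p :=
  fun x => [set F x + v | v in T x].

Definition zer (R : realType) (p : nat) (G : 'rV[R]_p -> set 'rV[R]_p) :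
    set 'rV[R]_p :=
  [set x | G x 0].

Definition resolvent (R : realType) (p : nat) (eta : R)
    (T : 'rV[R]_p -> set 'rV[R]_p) : 'rV[R]_p -> set 'rV[R]_p :=
  fun u => [set x | [set x + eta *: v | v in T x] u].

(* G is single-valued and everywhere defined, with underlying map J, and J is
   1-Lipschitz. *)
Definition nonexpansive_via (R : realType) (p : nat)
    (G : 'rV[R]_p -> set 'rV[R]_p) (J : 'rV[R]_p -> 'rV[R]_p) : Prop :=
  (forall u, G u = [set J u]) /\ elipschitz 1 J.

Definition residual (R : realType) (p : nat) (eta : R)
    (F J : 'rV[R]_p -> 'rV[R]_p) (x : 'rV[R]_p) : 'rV[R]_p :=
  eta^-1 *: (x - J (x - eta *: F x)).

(* The sequence k |-> w^{k-1}, where w^{-1} = (eta / etah_0) w^0. *)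
Definition wpred (R : realType) (p : nat) (eta : R) (etah : nat -> R)
    (w : nat -> 'rV[R]_p) (k : nat) : 'rV[R]_p :=
  if k is k'.+1 then w k' else (eta / etah 0%N) *: w 0%N.

(* The starting data are x 0 and xi 0. The first equation is a membership since
   the resolvent may be multivalued. For k = 0, aeg_x and aeg_w follow from the
   initialization as soon as eta and etah 0 are nonzero. *)
Record AEG (R : realType) (p : nat) (F : 'rV[R]_p -> 'rV[R]_p)
    (T : 'rV[R]_p -> set 'rV[R]_p) (eta gamma : R) (etah theta nu : nat -> R)
    (x y z w xi : nat -> 'rV[R]_p) : Prop := {
  aeg_xi0 : T (x 0%N) (xi 0%N);
  aeg_z0 : z 0%N = x 0%N;
  aeg_y0 : y 0%N = x 0%N;
  aeg_w0 : w 0%N = F (x 0%N) + xi 0%N;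
  aeg_x : forall k, resolvent eta T
    (y k - eta *: F (y k) + etah k *: wpred eta etah w k) (x k);
  aeg_w : forall k, w k =
    eta^-1 *: (y k - x k + etah k *: wpred eta etah w k) + F (x k) - F (y k);
  aeg_xi : forall k, xi k = w k - F (x k);
  aeg_z : forall k, z k.+1 = x k - gamma *: w k;
  aeg_y : forall k, y k.+1 =
    z k.+1 + theta k *: (z k.+1 - z k) + nu k *: (y k - z k.+1)
}.

(* Main.v *)
Require Import Defs.
From mathcomp Require Import all_boot all_order all_algebra.
From mathcomp Require Import boolp classical_sets reals.
From mathcomp Require Import ring lra.

(** The scheme is a Halpern-type anchored extragradient method in disguise.
    The momentum rule for [y] says exactly that [z^k + t_k (y^k - z^k)] does not
    depend on [k]; it equals [x^0], so every [y^k] is a convex combination of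
    the anchor [x^0] and [z^k] ([aeg_anchored]).  Eliminating [y] and [z], with [u^k := w^k - F x^k + F y^k]
    the extrapolated operator value, gives for [t = t_k]
<<
      x^k - x^0 = ((t - 1) / t) (x^(k-1) - x^0 + 2 rho w^(k-1)) - eta u^k,
      x^k - y^k = eta (((t - 1) / t) w^(k-1) - u^k).
>>
    Because [L eta <= 1], the Lipschitz bound on [F x^k - F y^k = w^k - u^k]
    becomes [|w^k - u^k| <= |u^k - ((t - 1) / t) w^(k-1)|].  Adding [t (t - 1)]
    times the co-hypomonotonicity inequality between [x^(k-1)] and [x^k] to
    [eta t^2 / 2] times the square of this bound makes all inner products
    between different [w]'s and [u]'s cancel; as [t_k - 1 = t_(k-1)], what is
    left says that the potential
<<
      V_k = (gamma t_k^2 / 2 + rho t_k) |w^k|^2 + t_k <w^k, x^k - x^0>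
>>
    does not increase ([anchored_step], [aeg_potential_le]).  Initially
    [V_0 = 2 (gamma + rho) |w^0|^2].  Conversely, co-hypomonotonicity between
    [x^k] and the solution bounds [<w^k, x^k - x^0>] from below by
    [- rho |w^k|^2 - <w^k, x^0 - xstar>]; the terms in [rho] cancel in [V_k], and
    Young's inequality leaves [gamma^2 t_k^2 |w^k|^2 / 4] controlled by
    [|x^0 - xstar|^2] and [gamma V_0] ([potential_rate]).  This yields the
    constant [8 gamma (gamma + rho)], smaller than the one claimed.

    For the residual, [x^k = J (x^k + eta xi^k)], so nonexpansiveness of [J]
    makes the residual at [x^k] no longer than [F x^k + xi^k]
    ([residual_le]). *)

Import Order.TTheory GRing.Theory Num.Theory.

Local Open Scope classical_set_scope.
Local Open Scope ring_scope.

(** * The Euclidean inner product *)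

Section InnerProduct.
Context {R : realType} {p : nat}.
Implicit Types (u v w : 'rV[R]_p) (a : R).

Lemma dotpC u v : dotp u v = dotp v u.
Proof. by apply: eq_bigr => i _; rewrite mulrC. Qed.

Lemma dotpDl u v w : dotp (u + v) w = dotp u w + dotp v w.
Proof. by rewrite /dotp -big_split; apply: eq_bigr => i _; rewrite mxE mulrDl. Qed.

Lemma dotpZl a u w : dotp (a *: u) w = a * dotp u w.
Proof. by rewrite /dotp mulr_sumr; apply: eq_bigr => i _; rewrite mxE mulrA. Qed.

Lemma dotpNl u w : dotp (- u) w = - dotp u w.
Proof. by rewrite -scaleN1r dotpZl mulN1r. Qed.

Lemma dotpDr u v w : dotp w (u + v) = dotp w u + dotp w v.
Proof. by rewrite dotpC dotpDl !(dotpC w). Qed.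

Lemma dotpZr a u w : dotp w (a *: u) = a * dotp w u.
Proof. by rewrite dotpC dotpZl (dotpC w). Qed.

Lemma dotpNr u w : dotp w (- u) = - dotp w u.
Proof. by rewrite dotpC dotpNl (dotpC w). Qed.

Definition dotpE := (dotpDl, dotpDr, dotpNl, dotpNr, dotpZl, dotpZr).

Lemma dotp_ge0 u : 0 <= dotp u u.
Proof. by apply: sumr_ge0 => i _; rewrite -expr2 sqr_ge0. Qed.

Lemma enorm_sqr u : enorm u ^+ 2 = dotp u u.
Proof. by rewrite sqr_sqrtr ?dotp_ge0. Qed.

Lemma enorm_ge0 u : 0 <= enorm u.
Proof. exact: sqrtr_ge0. Qed.

Lemma elipschitz_sqr {L} {F : 'rV[R]_p -> 'rV[R]_p} u v :
  elipschitz L F ->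
  dotp (F u - F v) (F u - F v) <= L ^+ 2 * dotp (u - v) (u - v).
Proof.
move=> F_lip; rewrite -!enorm_sqr -exprMn; have FL := F_lip u v.
by apply: lerXn2r => //; rewrite nnegrE ?(le_trans _ FL) ?enorm_ge0.
Qed.

End InnerProduct.

(** * Energy estimates *)

(** One step of the anchored iteration, with the anchor at the origin: [d], [a]
    are the previous point and operator value, [e], [b] the new ones, and [c]
    is the extrapolated operator value.  The weights [t * (t - 1)] and
    [eta * t ^+ 2 / 2] are the ones for which every inner product of two
    different vectors cancels, apart from [dotp b e] and [dotp a d]. *)
Lemma anchored_step {R : realType} {p : nat} (rho gamma eta t : R)
    (a b c d e : 'rV[R]_p) :
  0 <= gamma -> 0 <= rho -> 1 <= t -> eta = gamma + 2 * rho ->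
  e = ((t - 1) / t) *: (d + (2 * rho) *: a) - eta *: c ->
  0 <= dotp (b - a) (e - d) + rho * dotp (b - a) (b - a) ->
  dotp (b - c) (b - c) <=
    dotp (c - ((t - 1) / t) *: a) (c - ((t - 1) / t) *: a) ->
  (gamma * t ^+ 2 / 2 + rho * t) * dotp b b + t * dotp b e <=
  (gamma * (t - 1) ^+ 2 / 2 + rho * (t - 1)) * dotp a a + (t - 1) * dotp a d.
Proof.
move=> g0 r0 t1 etaE eE mono; rewrite -subr_ge0 => lip.
have t0 : 0 < t by lra.
have tn0 : t != 0 by rewrite gt_eqF.
have m1 : 0 <= t * (t - 1) by apply: mulr_ge0; lra.
have m2 : 0 <= eta * t ^+ 2 / 2.
  by rewrite divr_ge0 // mulr_ge0 ?sqr_ge0 // etaE; lra.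
rewrite -subr_ge0; move: (addr_ge0 (mulr_ge0 m1 mono) (mulr_ge0 m2 lip)).
congr (0 <= _).
rewrite eE etaE !dotpE (dotpC c a) (dotpC c b) (dotpC b a).
by field.
Qed.

(** Young's inequality enters as the nonnegativity of
    [|(gamma t / 2) w - v|^2], with [v] the anchor relative to the solution. *)
Lemma potential_rate {R : realType} {p : nat} {rho gamma t V : R}
    {w x x0 xs : 'rV[R]_p} :
  0 < gamma -> 0 < t ->
  (gamma * t ^+ 2 / 2 + rho * t) * dotp w w + t * dotp w (x - x0) <= V ->
  0 <= dotp w (x - xs) + rho * dotp w w ->
  dotp w w <= (4 * dotp (x0 - xs) (x0 - xs) + 4 * gamma * V)
                / (gamma ^+ 2 * t ^+ 2).
Proof.
move=> g0 t0; rewrite -subr_ge0 => hV mono.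
rewrite ler_pdivlMr ?mulr_gt0 ?exprn_gt0 //.
have young := dotp_ge0 ((gamma * t / 2) *: w - (x0 - xs)).
have m1 : 0 <= 4 * gamma by lra.
have m2 : 0 <= 4 * gamma * t by rewrite mulr_ge0 // ltW.
have m3 : 0 <= 4 :> R by lra.
rewrite -subr_ge0.
move: (addr_ge0 (addr_ge0 (mulr_ge0 m1 hV) (mulr_ge0 m2 mono))
         (mulr_ge0 m3 young)).
congr (0 <= _).
rewrite !dotpE (dotpC x0 w) (dotpC xs w).
by field.
Qed.

(** * The accelerated extragradient scheme *)

Lemma aeg_mem {R : realType} {p : nat} {F : 'rV[R]_p -> 'rV[R]_p}
    {T : 'rV[R]_p -> set 'rV[R]_p} {eta gamma : R} {etah theta nu : nat -> R}
    {x y z w xi : nat -> 'rV[R]_p} :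
  AEG F T eta gamma etah theta nu x y z w xi -> eta != 0 ->
  forall k, T (x k) (xi k).
Proof.
move=> H eta0 k; have [v Tv vE] := aeg_x H k.
suff -> : xi k = v by [].
apply: (scalerI eta0); apply: (addrI (x k)).
rewrite vE (aeg_xi H) (aeg_w H); apply/rowP => i; rewrite !mxE.
by field.
Qed.

(** Multiplied by [t_(k+1)], the momentum rule reads
    [t_(k+1) (y^(k+1) - z^(k+1)) = (t_k - 1) (z^(k+1) - z^k)
    + t_k (y^k - z^(k+1))], and adding [z^(k+1)] removes [z^(k+1)] from the right
    side altogether. *)
Lemma aeg_anchored {R : realType} {p : nat} {F : 'rV[R]_p -> 'rV[R]_p}
    {T : 'rV[R]_p -> set 'rV[R]_p} {eta gamma : R}
    {t etah theta nu : nat -> R} {x y z w xi : nat -> 'rV[R]_p} :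
  AEG F T eta gamma etah theta nu x y z w xi ->
  (forall k, t k.+1 != 0) ->
  (forall k, theta k = (t k - 1) / t k.+1) ->
  (forall k, nu k = t k / t k.+1) ->
  forall k, z k + t k *: (y k - z k) = x 0%N.
Proof.
move=> H t0 thetaE nuE; elim=> [|k IH].
  by rewrite (aeg_z0 H) (aeg_y0 H) subrr scaler0 addr0.
rewrite -IH (aeg_y H) thetaE nuE; apply/rowP => i; rewrite !mxE.
by field.
Qed.

Lemma aeg_potential_le {R : realType} {p : nat} {F : 'rV[R]_p -> 'rV[R]_p}
    {T : 'rV[R]_p -> set 'rV[R]_p} {L rho gamma eta : R}
    {t etah theta nu : nat -> R} {x y z w xi : nat -> 'rV[R]_p} :
  0 <= L -> elipschitz L F -> 0 <= rho -> cohypomonotone rho (opsum F T) ->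
  0 < gamma -> L * (2 * rho + gamma) <= 1 ->
  (forall k, t k = k%:R + 2) ->
  eta = gamma + 2 * rho ->
  (forall k, etah k = (t k - 1) * eta / t k) ->
  (forall k, theta k = (t k - 1) / t k.+1) ->
  (forall k, nu k = t k / t k.+1) ->
  AEG F T eta gamma etah theta nu x y z w xi ->
  forall k, (gamma * t k ^+ 2 / 2 + rho * t k) * dotp (w k) (w k)
      + t k * dotp (w k) (x k - x 0%N)
    <= 2 * (gamma + rho) * dotp (w 0%N) (w 0%N).
Proof.
move=> L0 F_lip r0 FT g0 Lg tE etaE etahE thetaE nuE H.
have eta0 : 0 < eta by rewrite etaE; lra.
have etan0 : eta != 0 by rewrite gt_eqF.
have t_ge2 k : 2 <= t k by rewrite tE lerDr.
have tn0 k : t k != 0 by rewrite gt_eqF //; have := t_ge2 k; lra.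
have tS k : t k.+1 - 1 = t k by rewrite !tE -natr1; ring.
have wmem k : opsum F T (x k) (w k).
  by exists (xi k); [exact: (aeg_mem H) | rewrite (aeg_xi H) addrC subrK].
elim=> [|k IH]; first by rewrite tE subrr -(scale0r 0) dotpZr; lra.
apply: le_trans IH; rewrite -[t k in leRHS]tS.
(* [u] is the operator value extrapolated at [y], that is [xi + F y]. *)
pose u := w k.+1 - F (x k.+1) + F (y k.+1).
have uE : eta *: u =
    y k.+1 - x k.+1 + ((t k.+1 - 1) * eta / t k.+1) *: w k.
  rewrite /u (aeg_w H) /= etahE; apply/rowP => i; rewrite !mxE.
  by field; rewrite etan0 tn0.
have yE : y k.+1 =
    (t k.+1)^-1 *: (x 0%N + (t k.+1 - 1) *: (x k - gamma *: w k)).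
  rewrite -(aeg_anchored H _ thetaE nuE k.+1) // (aeg_z H).
  by apply/rowP => i; rewrite !mxE; field.
have xyE : x k.+1 - y k.+1 = - eta *: (u - ((t k.+1 - 1) / t k.+1) *: w k).
  rewrite scalerBr scaleNr uE; apply/rowP => i; rewrite !mxE.
  by field.
apply: (@anchored_step _ _ rho gamma eta _ _ _ u) => //.
- exact: ltW.
- by have := t_ge2 k.+1; lra.
- rewrite uE yE etaE; apply/rowP => i; rewrite !mxE.
  by field.
- have -> : x k.+1 - x 0%N - (x k - x 0%N) = x k.+1 - x k.
    by rewrite opprB addrA subrK.
  by have := FT _ _ _ _ (wmem k.+1) (wmem k); rewrite enorm_sqr; lra.
have -> : w k.+1 - u = F (x k.+1) - F (y k.+1).
  by rewrite /u; apply/rowP => i; rewrite !mxE; ring.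
apply: le_trans (elipschitz_sqr _ _ F_lip) _.
rewrite xyE dotpZl dotpZr [- eta * (_ * _)]mulrA -expr2 sqrrN mulrA -exprMn.
rewrite -[leRHS]mul1r ler_wpM2r ?dotp_ge0 //.
by rewrite expr_le1 ?mulr_ge0 ?(ltW eta0) // etaE addrC.
Qed.

(** As [x = J (x + eta *: xi)], the residual is [1 / eta] times a difference of
    two values of [J], at points that differ by [eta *: (F x + xi)]. *)
Lemma residual_le {R : realType} {p : nat} {eta : R}
    {F J : 'rV[R]_p -> 'rV[R]_p} {T : 'rV[R]_p -> set 'rV[R]_p}
    {x xi : 'rV[R]_p} :
  0 < eta -> nonexpansive_via (resolvent eta T) J -> T x xi ->
  dotp (residual eta F J x) (residual eta F J x) <= dotp (F x + xi) (F x + xi).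
Proof.
move=> eta0 [JE J_lip] Txi.
have xE : x = J (x + eta *: xi).
  have : resolvent eta T (x + eta *: xi) x by exists xi.
  by rewrite JE.
rewrite /residual dotpZl dotpZr mulrA -expr2.
have := elipschitz_sqr (x + eta *: xi) (x - eta *: F x) J_lip.
have -> : x + eta *: xi - (x - eta *: F x) = eta *: (F x + xi).
  by apply/rowP => i; rewrite !mxE; ring.
rewrite -xE expr1n mul1r dotpZl dotpZr mulrA -expr2 => le_eta.
by rewrite exprVn mulrC ler_pdivrMr ?exprn_gt0 // mulrC.
Qed.

Theorem theorem3p1 (R : realType) (p : nat)
    (F : 'rV[R]_p -> 'rV[R]_p) (T : 'rV[R]_p -> set 'rV[R]_p)
    (L rho gamma eta : R) (t etah theta nu : nat -> R)
    (xstar : 'rV[R]_p) (x y z w xi : nat -> 'rV[R]_p)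
    (L_gt0 : 0 < L) (F_lip : elipschitz L F)
    (rho_ge0 : 0 <= rho) (Lrho : 2 * L * rho < 1)
    (FT_cohypo : cohypomonotone rho (opsum F T))
    (xstar_zer : zer (opsum F T) xstar)
    (gamma_gt0 : 0 < gamma) (Lgamma : L * (2 * rho + gamma) <= 1)
    (tE : forall k, t k = k%:R + 2)
    (etaE : eta = gamma + 2 * rho)
    (etahE : forall k, etah k = (t k - 1) * eta / t k)
    (thetaE : forall k, theta k = (t k - 1) / t k.+1)
    (nuE : forall k, nu k = t k / t k.+1)
    (xyzw_AEG : AEG F T eta gamma etah theta nu x y z w xi) :
  (forall k, T (x k) (xi k) /\
    enorm (F (x k) + xi k) ^+ 2 <=
      (4 * enorm (x 0%N - xstar) ^+ 2
        + 8 * gamma * (3 * gamma + 2 * rho) * enorm (F (x 0%N) + xi 0%N) ^+ 2)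
      / (gamma ^+ 2 * (k%:R + 2) ^+ 2)) /\
  (forall J : 'rV[R]_p -> 'rV[R]_p, nonexpansive_via (resolvent eta T) J ->
    forall k, enorm (residual eta F J (x k)) ^+ 2 <=
      (4 * enorm (x 0%N - xstar) ^+ 2
        + 8 * gamma * (3 * gamma + 2 * rho) * enorm (F (x 0%N) + xi 0%N) ^+ 2)
      / (gamma ^+ 2 * (k%:R + 2) ^+ 2)).
Proof.
have eta0 : 0 < eta by rewrite etaE; lra.
have xi_mem : forall k, T (x k) (xi k).
  by apply: (aeg_mem xyzw_AEG); rewrite gt_eqF.
have wE k : F (x k) + xi k = w k by rewrite (aeg_xi xyzw_AEG) addrC subrK.
have rate k : dotp (w k) (w k) <=
    (4 * enorm (x 0%N - xstar) ^+ 2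
      + 8 * gamma * (3 * gamma + 2 * rho) * enorm (F (x 0%N) + xi 0%N) ^+ 2)
    / (gamma ^+ 2 * (k%:R + 2) ^+ 2).
  have t0 : 0 < k%:R + 2 :> R by rewrite ltr_wpDl.
  have := aeg_potential_le (ltW L_gt0) F_lip rho_ge0 FT_cohypo gamma_gt0 Lgamma
    tE etaE etahE thetaE nuE xyzw_AEG k.
  rewrite tE => Vk.
  have mono : 0 <= dotp (w k) (x k - xstar) + rho * dotp (w k) (w k).
    have wmem : opsum F T (x k) (w k) by exists (xi k).
    have := FT_cohypo _ _ _ _ wmem xstar_zer.
    by rewrite subr0 enorm_sqr; lra.
  apply: le_trans (potential_rate gamma_gt0 t0 Vk mono) _.
  rewrite wE !enorm_sqr ler_pM2r ?invr_gt0 ?mulr_gt0 ?exprn_gt0 //.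
  rewrite lerD2l -subr_ge0.
  have : 0 <= 8 * gamma * (2 * gamma + rho) * dotp (w 0%N) (w 0%N).
    by rewrite !mulr_ge0 ?dotp_ge0 //; lra.
  congr (0 <= _); ring.
split=> [k|J J_nonexp k]; first by rewrite enorm_sqr wE.
rewrite enorm_sqr; apply: le_trans (rate k).
by rewrite -wE; exact: (residual_le eta0 J_nonexp (xi_mem k)).
Qed.
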